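(* Let $a(t)=\sum_{k\ge0}a_k(t-b)^{k/3}$ be the $4$-parameter Puiseux series solution, with free parameters $b,a_0,a_9,a_{11}$ and $a_1=-1$, $a_2=a_3=a_4=0$, $a_5=-\tfrac67b$, $a_6=0$, $a_7=\tfrac{10}{21}a_0$, $a_8=-\tfrac32$, $a_{10}=0$, $a_{12}=-\tfrac{135}{49}b$, …, of the equation $$a''''+120(a')^3a''-120a'a''t-\tfrac{200}3(a')^2-\tfrac{40}3aa''+\tfrac{200}9t=0,$$ and let $$\mathcal A=-\tfrac3{20}a''\sigma_3+\bigl(\tfrac1{30}\lambda^4+\alpha_3\lambda^3+\alpha_2\lambda^2+\alpha_1\lambda+\alpha_0\bigr)\sigma_++\bigl(\tfrac1{30}\lambda-\alpha_3\bigr)\sigma_-,$$ $$\alpha_3=-\tfrac1{10}a',\quad \alpha_2=\tfrac3{10}(a')^2-t,\quad \alpha_1=-\tfrac9{10}(a')^3+3a't+a,$$ $$\alpha_0=3aa'-\tfrac{27}4(a')^4+\tfrac95t(a')^2+\tfrac{27}{20}c_6+\tfrac{81}5t^2,\quad c_6=-\tfrac13a'''-3(a')^4+12(a')^2t-12t^2.$$ Then the gauge transformation $X=QZ$, rational in $\lambda$ and $(t-b)^{1/3}$, with the gauge matrix $$\begin{aligned}Q(\lambda)=\;&\sigma_3\bigl(\tfrac{120}7b-\lambda^2\bigr)^{-\frac12\sigma_3}(t-b)^{\frac16\sigma_3}\tfrac1{\sqrt2}(\sigma_3+\sigma_1)\\&\times2^{-\sigma_3}\lambda^{-\frac12\sigma_3}\bigl(\tfrac{120}7b-\lambda^2\bigr)^{\frac12\sigma_3}(t-b)^{\frac13\sigma_3}\tfrac1{\sqrt2}(\sigma_3+\sigma_1)\\&\times\lambda^{\frac12\sigma_3}(t-b)^{\frac13\sigma_3}2^{-\frac12\sigma_3}\tfrac1{\sqrt2}(\sigma_3+\sigma_1)(t-b)^{\frac12\sigma_3}\end{aligned}$$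 regularizes the connection $\partial_\lambda-\mathcal A$ at the branch point $t=b$.
   Context: Primes denote $d/dt$. $\sigma_3=\begin{pmatrix}1&0\\0&-1\end{pmatrix}$, $\sigma_1=\begin{pmatrix}0&1\\1&0\end{pmatrix}$, $\sigma_+=\begin{pmatrix}0&1\\0&0\end{pmatrix}$, $\sigma_-=\begin{pmatrix}0&0\\1&0\end{pmatrix}$; for a scalar $f$, $f^{s\sigma_3}=\mathrm{diag}(f^s,f^{-s})$ (consistent branches fixed throughout). In the Puiseux series $b,a_0,a_9,a_{11}$ are arbitrary and all other coefficients are determined recursively by the equation. Here $Z$ satisfies $Z_\lambda=\mathcal AZ$; under $X=QZ$ the connection matrix becomes $Q\mathcal AQ^{-1}+Q_\lambda Q^{-1}$. The gauge transformation regularizes the connection at $t=b$ if the expansion of this transformed matrix in powers of $(t-b)^{1/3}$ contains no negative powers. *)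

(* Defs.v *)
From HB Require Import structures.
From mathcomp Require Import all_boot all_order all_algebra.
From mathcomp Require Import complex.
From mathcomp Require Import all_classical all_reals all_analysis.
From mathcomp Require Import zify.
Import Order.TTheory GRing.Theory Num.Theory.
Import numFieldNormedType.Exports.
Set Implicit Arguments.
Unset Strict Implicit.
Unset Printing Implicit Defensive.
Local Open Scope classical_set_scope.
Local Open Scope ring_scope.

Definition bounded_order (F : fieldType) (x : int -> F) :=
  exists N : int, forall n, n < N -> x n = 0.

(* The field F((u)) of formal Laurent series: coef f n is the coefficient of
   u ^ n in f. *)
Record laurent (F : fieldType) := Laurent {
  coef :> int -> F;
  coef_bounded : bounded_order coef }.

HB.instance Definition _ (F : fieldType) := gen_eqMixin (laurent F).
HB.instance Definition _ (F : fieldType) := gen_choiceMixin (laurent F).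

Section LaurentRing.
Variable F : fieldType.
Implicit Types (x y z : int -> F) (f g h : laurent F) (N M P n : int).

Lemma laurentP f g : (forall n, f n = g n) -> f = g.
Proof.
case: f g => [x xP] [y yP] /= /funext xy; case: _ / xy yP => yP.
by congr Laurent; exact: Prop_irrelevance.
Qed.

(* A finite sum when x and y are both of bounded order. *)
Definition conv x y n : F := \sum_(i \in [set: int]) x i * y (n - i).

Lemma convE x y N M n (K : nat) :
  (forall i, i < N -> x i = 0) -> (forall i, i < M -> y i = 0) ->
  n < N + M + K%:Z ->
  conv x y n = \sum_(k < K) x (N + k%:Z) * y (n - (N + k%:Z)).
Proof.
move=> xN yM nK; rewrite /conv.
rewrite (fsbig_widen _ [set: int] _)//; last by move=> i [].
rewrite -(fsbig_widen [set` [seq N + k%:Z | k <- iota 0 K]])//; last first.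
  move=> i [_ /= iK]; case: (ltP i N) => [/xN->|Ni]; first by rewrite mul0r.
  rewrite yM ?mulr0// ltNge; apply/negP => Mi; apply: iK.
  apply/mapP; exists `|i - N|%N; last lia.
  rewrite mem_iota; lia.
rewrite -fsbig_seq; last first.
  by rewrite map_inj_uniq ?iota_uniq// => i j; lia.
by rewrite big_map -{1}[K]subn0 -/(index_iota 0 K) big_mkord.
Qed.

Definition trunc x N (L : nat) : {poly F} := \poly_(k < L) x (N + k%:Z).

Lemma conv_trunc x y N M (m L : nat) :
  (forall i, i < N -> x i = 0) -> (forall i, i < M -> y i = 0) ->
  (m < L)%N -> conv x y (N + M + m%:Z) = (trunc x N L * trunc y M L)`_m.
Proof.
move=> xN yM mL; rewrite (@convE _ _ N M _ m.+1)//; last lia.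
rewrite coefM; apply: eq_bigr => -[k /= km] _; rewrite !coef_poly.
by rewrite !ifT; try lia; congr (_ * y _); lia.
Qed.

Lemma conv_lt x y N M n :
  (forall i, i < N -> x i = 0) -> (forall i, i < M -> y i = 0) ->
  n < N + M -> conv x y n = 0.
Proof. by move=> xN yM nK; rewrite (@convE _ _ N M _ 0) ?addr0// big_ord0. Qed.

Lemma convC x y : bounded_order x -> bounded_order y -> conv x y =1 conv y x.
Proof.
move=> [N xN] [M yM] n; case: (ltP n (N + M)) => nNM.
  by rewrite (conv_lt xN yM)// (conv_lt yM xN)// addrC.
have -> : n = N + M + (absz (n - (N + M))%R)%:Z by lia.
rewrite (conv_trunc xN yM (ltnSn _)) [N + M]addrC (conv_trunc yM xN (ltnSn _)).
by rewrite mulrC.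
Qed.

Lemma convA x y z : bounded_order x -> bounded_order y -> bounded_order z ->
  conv x (conv y z) =1 conv (conv x y) z.
Proof.
move=> [N xN] [M yM] [P zP] n.
have xyN i : i < N + M -> conv x y i = 0 by exact: conv_lt.
have yzN i : i < M + P -> conv y z i = 0 by exact: conv_lt.
case: (ltP n (N + M + P)) => nNM.
  by rewrite (conv_lt xN yzN) ?addrA// (conv_lt xyN zP).
have [m ->] : exists m : nat, n = N + M + P + m%:Z.
  by exists (absz (n - (N + M + P))%R); lia.
rewrite (conv_trunc xyN zP (ltnSn _)) -[N + M + P]addrA.
rewrite (conv_trunc xN yzN (ltnSn _)).
transitivity ((trunc x N m.+1 * (trunc y M m.+1 * trunc z P m.+1))`_m).
  rewrite !coefM; apply: eq_bigr => -[k /= km] _; congr (_ * _).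
  by rewrite coef_poly ifT ?(conv_trunc yM zP (L := m.+1))//; lia.
rewrite mulrA !coefM; apply: eq_bigr => -[k /= km] _; congr (_ * _).
by rewrite coef_poly ifT ?(conv_trunc xN yM (L := m.+1))//; lia.
Qed.

Lemma convDl x y z : bounded_order x -> bounded_order y -> bounded_order z ->
  conv (fun n => x n + y n) z =1 (fun n => conv x z n + conv y z n).
Proof.
move=> [N xN] [M yM] [P zP] n; pose K := Order.min N M.
have xK i : i < K -> x i = 0 by rewrite lt_min => /andP[/xN].
have yK i : i < K -> y i = 0 by rewrite lt_min => /andP[_ /yM].
have xyK i : i < K -> x i + y i = 0 by move=> iK; rewrite xK ?yK ?addr0.
have nL : n < K + P + (absz (n - (K + P))%R).+1%:Z by lia.
rewrite (convE xyK zP nL) (convE xK zP nL) (convE yK zP nL) -big_split/=.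
by apply: eq_bigr => k _; rewrite mulrDl.
Qed.

Lemma monomial_bounded (c : F) (k : int) :
  bounded_order (fun n => if n == k then c else 0).
Proof. by exists k => n; rewrite lt_neqAle => /andP[/negPf ->]. Qed.

Definition monomial (c : F) (k : int) := Laurent (monomial_bounded c k).

Lemma conv_monomial (c : F) k y n : bounded_order y ->
  conv (monomial c k) y n = c * y (n - k).
Proof.
move=> [M yM].
have cN i : i < k -> monomial c k i = 0.
  by rewrite lt_neqAle => /andP[/negPf /= ->].
have nL : n < k + M + (absz (n - (k + M))%R).+1%:Z by lia.
rewrite (convE cN yM nL) big_ord_recl/= addr0 eqxx big1 ?addr0// => i _.
by rewrite ifF ?mul0r//; apply/eqP; rewrite /bump /=; lia.
Qed.

Lemma add_bounded f g : bounded_order (fun n => f n + g n).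
Proof.
have [[N fN] [M gM]] := (coef_bounded f, coef_bounded g).
exists (Order.min N M) => i; rewrite lt_min => /andP[iN iM].
by rewrite fN ?gM ?addr0.
Qed.

Lemma opp_bounded f : bounded_order (fun n => - f n).
Proof.
by have [N fN] := coef_bounded f; exists N => i /fN ->; rewrite oppr0.
Qed.

Lemma scale_bounded (c : F) f : bounded_order (fun n => c * f n).
Proof.
by have [N fN] := coef_bounded f; exists N => i /fN ->; rewrite mulr0.
Qed.

Lemma mul_bounded f g : bounded_order (conv f g).
Proof.
have [[N fN] [M gM]] := (coef_bounded f, coef_bounded g).
by exists (N + M) => i; exact: conv_lt.
Qed.

Definition addl f g := Laurent (add_bounded f g).
Definition oppl f := Laurent (opp_bounded f).
Definition scalel c f := Laurent (scale_bounded c f).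
Definition mull f g := Laurent (mul_bounded f g).

Fact addlA : associative addl.
Proof. by move=> f g h; apply: laurentP => n /=; rewrite addrA. Qed.
Fact addlC : commutative addl.
Proof. by move=> f g; apply: laurentP => n /=; rewrite addrC. Qed.
Fact add0l : left_id (monomial 0 0) addl.
Proof. by move=> f; apply: laurentP => n /=; rewrite if_same add0r. Qed.
Fact addNl : left_inverse (monomial 0 0) oppl addl.
Proof. by move=> f; apply: laurentP => n /=; rewrite if_same addNr. Qed.

HB.instance Definition _ := GRing.isZmodule.Build (laurent F)
  addlA addlC add0l addNl.

Fact mullA : associative mull.
Proof.
by move=> f g h; apply: laurentP => n /=; apply: convA; exact: coef_bounded.
Qed.
Fact mullC : commutative mull.
Proof.
by move=> f g; apply: laurentP => n /=; apply: convC; exact: coef_bounded.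
Qed.
Fact mul1l : left_id (monomial 1 0) mull.
Proof.
move=> f; apply: laurentP => n /=.
by rewrite (conv_monomial 1 0 n (coef_bounded f)) mul1r subr0.
Qed.
Fact mullDl : left_distributive mull addl.
Proof.
by move=> f g h; apply: laurentP => n /=; apply: convDl; exact: coef_bounded.
Qed.
Fact onel_neq0 : monomial 1 0 != 0.
Proof.
apply/eqP => /(congr1 (fun f : laurent F => f 0)) /= /eqP.
by rewrite oner_eq0.
Qed.

HB.instance Definition _ := GRing.Zmodule_isComNzRing.Build (laurent F)
  mullA mullC mul1l mullDl onel_neq0.

Fact scalelA c d f : scalel c (scalel d f) = scalel (c * d) f.
Proof. by apply: laurentP => n /=; rewrite mulrA. Qed.
Fact scale1l : left_id 1 scalel.
Proof. by move=> f; apply: laurentP => n /=; rewrite mul1r. Qed.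
Fact scalelDr : right_distributive scalel +%R.
Proof. by move=> c f g; apply: laurentP => n /=; rewrite mulrDr. Qed.
Fact scalelDl f : {morph scalel^~ f : c d / c + d}.
Proof. by move=> c d; apply: laurentP => n /=; rewrite mulrDl. Qed.

HB.instance Definition _ := GRing.Zmodule_isLmodule.Build F (laurent F)
  scalelA scale1l scalelDr scalelDl.

Lemma scalelE c f : c *: f = monomial c 0 * f.
Proof.
apply: laurentP => n.
by rewrite [RHS](conv_monomial c 0 n (coef_bounded f)) subr0.
Qed.

Fact scalelAl c f g : c *: (f * g) = c *: f * g.
Proof. by rewrite !scalelE mulrA. Qed.

HB.instance Definition _ := GRing.Lmodule_isLalgebra.Build F (laurent F)
  scalelAl.
HB.instance Definition _ := GRing.Lalgebra_isComAlgebra.Build F (laurent F).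

(* Units and inverses are the true ones, found by classical choice. *)
Definition unitl : pred (laurent F) := fun f => `[< exists g, g * f = 1 >].
Definition invl f :=
  if pselect (exists g, g * f = 1) is left fP then projT1 (cid fP) else f.

Fact mulVl : {in unitl, left_inverse 1 invl *%R}.
Proof.
by move=> f /asboolP fP; rewrite /invl; case: pselect => // ?; case: cid.
Qed.
Fact unitlP f g : g * f = 1 -> unitl f.
Proof. by move=> gf; apply/asboolP; exists g. Qed.
Fact invl_out : {in [predC unitl], invl =1 id}.
Proof. by move=> f /asboolPn fP; rewrite /invl; case: pselect. Qed.

HB.instance Definition _ := GRing.ComNzRing_hasMulInverse.Build (laurent F)
  mulVl unitlP invl_out.

End LaurentRing.

(* Formal expansions at the point t = b.  The variable of laurent F is
   u = (t - b)^(1/6), because the gauge matrix involves sixth roots of t - b;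
   the local parameter is (t - b)^(1/3) = u ^ 2, and t - b = u ^ 6. *)
Section Puiseux.
Variable F : fieldType.

Definition u : laurent F := monomial 1 1.

Definition tvar (b : F) : laurent F := b%:A + u ^+ 6.

Fact thirds_bounded (c : nat -> F) : bounded_order
  (fun n : int => if n is Posz k then if odd k then 0 else c k./2 else 0).
Proof. by exists 0 => -[]. Qed.

(* sum over k >= 0 of c_k (t - b)^(k/3) *)
Definition thirds (c : nat -> F) := Laurent (thirds_bounded c).

Fact ddt_bounded (f : laurent F) :
  bounded_order (fun n => (n + 6)%:~R / 6 * f (n + 6)).
Proof.
have [N fN] := coef_bounded f; exists (N - 6) => n nN.
by rewrite fN ?mulr0// -ltrBrDr.
Qed.

(* d/dt, i.e. (t - b)^(m/6) |-> (m/6) (t - b)^((m - 6)/6) termwise *)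
Definition ddt (f : laurent F) := Laurent (ddt_bounded f).

Definition solves_ode (b : F) (a : laurent F) : Prop :=
  let t := tvar b in
  let a' := ddt a in
  let a'' := ddt a' in
  let a'''' := ddt (ddt a'') in
  a'''' + 120 *: (a' ^+ 3 * a'') - 120 *: (a' * a'' * t)
    - (200 / 3) *: a' ^+ 2 - (40 / 3) *: (a * a'') + (200 / 9) *: t = 0.

Definition puiseux_solution (b a0 a9 a11 : F) (c : nat -> F) : Prop :=
  solves_ode b (thirds c) /\
  [/\ c 0%N = a0, c 9%N = a9 & c 11%N = a11] /\
  [/\ c 1%N = -1, c 2%N = 0, c 3%N = 0 & c 4%N = 0] /\
  [/\ c 5%N = - (6 / 7) * b, c 6%N = 0, c 7%N = 10 / 21 * a0 & c 8%N = - (3 / 2)] /\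
  (c 10%N = 0 /\ c 12%N = - (135 / 49) * b).

Definition mx2 (p q r s : laurent F) : 'M[laurent F]_2 :=
  \matrix_(i, j) nth 0 (nth [::] [:: [:: p; q]; [:: r; s]] i) j.

Definition sigma3 := mx2 1 0 0 (-1).
Definition sigma1 := mx2 0 1 1 0.
Definition sigma_plus := mx2 0 1 0 0.
Definition sigma_minus := mx2 0 0 1 0.

(* g^(s sigma_3), the argument f being the chosen branch of g^s *)
Definition pow_sigma3 (f : laurent F) := mx2 f 0 0 f^-1.

(* The connection matrix at the value lam of the spectral parameter *)
Definition connection (b : F) (a : laurent F) (lam : F) : 'M[laurent F]_2 :=
  let t := tvar b in
  let a' := ddt a in
  let a'' := ddt a' in
  let a''' := ddt a'' in
  let c6 := - (1 / 3) *: a''' - 3 *: a' ^+ 4 + 12 *: (a' ^+ 2 * t)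
            - 12 *: t ^+ 2 in
  let alpha3 := - (1 / 10) *: a' in
  let alpha2 := (3 / 10) *: a' ^+ 2 - t in
  let alpha1 := - (9 / 10) *: a' ^+ 3 + 3 *: (a' * t) + a in
  let alpha0 := 3 *: (a * a') - (27 / 4) *: a' ^+ 4
                + (9 / 5) *: (t * a' ^+ 2) + (27 / 20) *: c6
                + (81 / 5) *: t ^+ 2 in
  (- (3 / 20) *: a'') *: sigma3
  + ((1 / 30 * lam ^+ 4)%:A + lam ^+ 3 *: alpha3 + lam ^+ 2 *: alpha2
     + lam *: alpha1 + alpha0) *: sigma_plus
  + ((1 / 30 * lam)%:A - alpha3) *: sigma_minus.

(* The gauge matrix.  sqrt2, sqlam, sqw stand for the chosen values of
   2^(1/2), lam^(1/2) and (120/7 b - lam^2)^(1/2). *)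
Definition gauge (sqrt2 sqlam sqw : F) : 'M[laurent F]_2 :=
  let H := (sqrt2^-1)%:A *: (sigma3 + sigma1) in
  sigma3 *m pow_sigma3 (sqw^-1)%:A *m pow_sigma3 u *m H
  *m pow_sigma3 (2^-1)%:A *m pow_sigma3 (sqlam^-1)%:A *m pow_sigma3 sqw%:A
  *m pow_sigma3 (u ^+ 2) *m H
  *m pow_sigma3 sqlam%:A *m pow_sigma3 (u ^+ 2) *m pow_sigma3 (sqrt2^-1)%:A
  *m H *m pow_sigma3 (u ^+ 3).

(* The value at (lam, (t - b)^(1/3)) of a polynomial in two variables, the
   outer variable being (t - b)^(1/3). *)
Definition eval2 (lam : F) (p : {poly {poly F}}) : laurent F :=
  (map_poly (fun q : {poly F} => q.[lam]%:A) p).[u ^+ 2].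

(* Q is given on D by a matrix of rational functions in lam and
   (t - b)^(1/3). *)
Definition rational_on (D : set F) (Q : F -> 'M[laurent F]_2) : Prop :=
  exists (d : {poly {poly F}}) (P : 'M[{poly {poly F}}]_2),
    forall lam, D lam ->
      eval2 lam d != 0 /\
      forall i j, eval2 lam d * Q lam i j = eval2 lam (P i j).

End Puiseux.
Arguments u {F}.

(* The topology and the norm of the complex plane are carried by R[i]^o. *)
Section Regularization.
Variable R : realType.
Implicit Types (D : set R[i]^o) (A Q : R[i] -> 'M[laurent R[i]]_2).

(* Coefficientwise complex derivative in lam *)
Definition is_lam_derivative Q (lam : R[i]^o) (dQ : 'M[laurent R[i]]_2) :=
  forall i j n,
    is_derive lam 1 (fun l : R[i]^o => Q l i j n : R[i]^o) (dQ i j n).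

(* On D, the transformed matrix Q A Q^-1 + Q_lam Q^-1 is a series in
   nonnegative powers of (t - b)^(1/3). *)
Definition regularizes D A Q : Prop :=
  forall lam, D lam ->
    Q lam \in unitmx /\
    exists2 dQ, is_lam_derivative Q lam dQ &
      forall i j, exists c : nat -> R[i],
        (Q lam *m A lam *m invmx (Q lam) + dQ *m invmx (Q lam)) i j = thirds c.

End Regularization.

(* Main.v *)
Require Import Defs.
From HB Require Import structures.
From mathcomp Require Import all_boot all_order all_algebra.
From mathcomp Require Import complex.
From mathcomp Require Import all_classical all_reals all_analysis.
From mathcomp Require Import zify ring.
Import Order.TTheory GRing.Theory Num.Theory.
Import numFieldNormedType.Exports.
Set Implicit Arguments.
Unset Strict Implicit.
Unset Printing Implicit Defensive.
Local Open Scope classical_set_scope.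
Local Open Scope ring_scope.

(* Put v = (t - b)^(1/3), l = lambda and W = 120/7 b - l^2.  Multiplying out
   the factors of Q, the square roots of 2, l and W and the odd powers of
   (t - b)^(1/6) cancel, and the entries of Q are three-term Laurent
   polynomials in v whose coefficients are rational in l and W; moreover det Q = 1, so that
   Q^-1 is the adjugate of Q.  With A = [[p, q], [r, -p]], the entries of
   Q A Q^-1 are linear in p, q, r, with leading power v^-9, v^-8, v^-10 and
   v^-9.  Since Q_lambda Q^-1 only starts at v^-4, it suffices to know p, q, r
   up to a factor 1 + O(v^10), which involves only a_0, ..., a_10: the negative
   powers then cancel identically once b is eliminated in favour of
   W + l^2. *)

(** * Truncated expansions *)

Section LaurentCoef.
Variable F : fieldType.
Implicit Types (f g : laurent F) (m n N M : int) (x y : F) (s t : seq F).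

Lemma coef_addl f g n : (f + g) n = f n + g n. Proof. by []. Qed.
Lemma coef_oppl f n : (- f) n = - f n. Proof. by []. Qed.
Lemma coef_zerol n : (0 : laurent F) n = 0. Proof. exact: if_same. Qed.
Lemma coef_scalel x f n : (x *: f) n = x * f n. Proof. by []. Qed.
Lemma coef_monomial x k n : monomial x k n = if n == k then x else 0.
Proof. by []. Qed.
Lemma coef_mul_monomial x k f n : (monomial x k * f) n = x * f (n - k).
Proof. exact: conv_monomial (coef_bounded f). Qed.

Lemma monomialM x k y m :
  monomial x k * monomial y m = monomial (x * y) (k + m).
Proof.
apply: laurentP => n; rewrite coef_mul_monomial !coef_monomial.
by rewrite (_ : (n - k == m) = (n == k + m)) ?[x * _]fun_if ?mulr0//; lia.
Qed.

Lemma monomialD x y k : monomial x k + monomial y k = monomial (x + y) k.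
Proof.
apply: laurentP => n; rewrite coef_addl !coef_monomial.
by case: ifP; rewrite ?addr0.
Qed.

Lemma monomialN x k : - monomial x k = monomial (- x) k.
Proof.
apply: laurentP => n; rewrite coef_oppl !coef_monomial.
by case: ifP; rewrite ?oppr0.
Qed.

Lemma monomial0 k : monomial 0 k = 0 :> laurent F.
Proof. by apply: laurentP => n; rewrite coef_zerol coef_monomial if_same. Qed.

Lemma algE x : x%:A = monomial x 0 :> laurent F.
Proof. by rewrite scalelE mulr1. Qed.

Lemma monomialX x k (i : nat) : monomial x k ^+ i = monomial (x ^+ i) (k *+ i).
Proof.
elim: i => [|i IHi]; first by rewrite !expr0 mulr0n.
by rewrite !exprS IHi monomialM mulrS.
Qed.

Lemma monomialV x k : x != 0 -> (monomial x k)^-1 = monomial x^-1 (- k).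
Proof.
move=> x0; have xV : monomial x^-1 (- k) * monomial x k = 1.
  by rewrite monomialM mulVf// addNr.
have xU : monomial x k \is a GRing.unit.
  by apply/unitrPr; exists (monomial x^-1 (- k)); rewrite mulrC.
by apply: (mulIr xU); rewrite mulVr.
Qed.

Lemma scale_monomial x y k : x *: monomial y k = monomial (x * y) k.
Proof. by rewrite scalelE monomialM add0r. Qed.

(* The Laurent polynomial s_0 v^N + s_1 v^(N+1) + ..., where v = u^2 is the
   local parameter (t - b)^(1/3). *)
Fixpoint vpoly N s : laurent F :=
  if s is x :: s' then monomial x (2 * N) + vpoly (N + 1) s' else 0.

Lemma vpoly_cons N x s :
  vpoly N (x :: s) = monomial x (2 * N) + vpoly (N + 1) s.
Proof. by []. Qed.

(* f is v^N times a power series in v; in particular its odd coefficients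
   vanish. *)
Definition order_ge N f :=
  forall n, f n != 0 -> exists k : nat, n = 2 * (N + k%:Z).

(* f = s_0 v^N + s_1 v^(N+1) + ... up to a multiple of v^(N + size s) *)
Fixpoint expands N s f :=
  if s is x :: s' then expands (N + 1) s' (f - monomial x (2 * N))
  else order_ge N f.

(** A sum is known only to the precision of its less precise summand, so the shorter list decides
    the length. *)
Fixpoint add_seq s t :=
  match s, t with x :: s', y :: t' => x + y :: add_seq s' t' | _, _ => [::] end.

(* The Cauchy product, cut at the precision of the shorter factor *)
Fixpoint mul_seq s t :=
  match s, t with
  | x :: s', y :: t' => x * y :: add_seq [seq x * z | z <- t'] (mul_seq s' t)
  | _, _ => [::]
  end.

Lemma order_geW N M f : M <= N -> order_ge N f -> order_ge M f.
Proof.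
move=> MN fN n /fN[k ->]; exists (`|N - M|%N + k)%N; lia.
Qed.

Lemma order_ge_monomial N x : order_ge N (monomial x (2 * N)).
Proof.
move=> n; rewrite coef_monomial.
case: (n =P 2 * N) => [->|_]; last by rewrite eqxx.
by exists 0%N; lia.
Qed.

Lemma order_geD N f g : order_ge N f -> order_ge N g -> order_ge N (f + g).
Proof.
move=> fN gN n; rewrite coef_addl; case: (eqVneq (f n) 0) => [->|/fN//].
by rewrite add0r => /gN.
Qed.

Lemma order_geZ N x f : order_ge N f -> order_ge N (x *: f).
Proof.
move=> fN n; rewrite coef_scalel => xf; apply: fN; apply: contraNneq xf => ->.
by rewrite mulr0.
Qed.

Lemma order_ge0 N : order_ge N 0.
Proof. by move=> n; rewrite coef_zerol eqxx. Qed.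

(** A nonzero term of the convolution forces both of its indices to be even and large enough; their
    sum then has the required form. *)
Lemma order_geM N M f g :
  order_ge N f -> order_ge M g -> order_ge (N + M) (f * g).
Proof.
move=> fN gM n; apply: contraNP => nNM.
have f0 i : i < 2 * N -> f i = 0.
  by move=> iN; apply/eqP; apply: contraT => /fN[k]; lia.
have g0 i : i < 2 * M -> g i = 0.
  by move=> iM; apply/eqP; apply: contraT => /gM[k]; lia.
have nK : n < 2 * N + 2 * M + (absz (n - (2 * N + 2 * M))%R).+1%:Z by lia.
rewrite [(f * g) n](convE f0 g0 nK) big1// => i _.
have [->|/fN[k ik]] := eqVneq (f (2 * N + i%:Z)) 0; first by rewrite mul0r.
have [->|/gM[l il]] := eqVneq (g (n - (2 * N + i%:Z))) 0.
  by rewrite mulr0.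
by case: nNM; exists (k + l)%N; lia.
Qed.

(** Separates building an expansion from simplifying it: the list comes out of the rules below, and
    the field identities are left to the goal [t = s]. *)
Lemma expands_eq N M s t f : expands M t f -> M = N -> t = s -> expands N s f.
Proof. by move=> + <- <-. Qed.

Lemma expands_behead N s f : expands N (0 :: s) f -> expands (N + 1) s f.
Proof. by rewrite /= monomial0 subr0. Qed.

Lemma expands_order N s f : expands N s f -> order_ge N f.
Proof.
elim: s N f => //= x s IHs N f /IHs fN.
rewrite -[f](subrK (monomial x (2 * N))).
apply: order_geD; last exact: order_ge_monomial.
by apply: order_geW fN; lia.
Qed.

Lemma expandsD N s t f g :
  expands N s f -> expands N t g -> expands N (add_seq s t) (f + g).
Proof.
elim: s t N f g => [|x s IHs] [|y t] N f g;
  try by move=> /expands_order + /expands_order; exact: order_geD.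
by move=> /= fs gt; rewrite -monomialD opprD addrACA; exact: IHs.
Qed.

Lemma expandsZ N s f x :
  expands N s f -> expands N [seq x * z | z <- s] (x *: f).
Proof.
elim: s N f => [|y s IHs] N f /=; first exact: order_geZ.
by move=> /IHs; rewrite scalerBr scale_monomial.
Qed.

Lemma expandsN N s f : expands N s f -> expands N [seq - z | z <- s] (- f).
Proof.
move=> /(expandsZ (-1)); rewrite scaleN1r; congr expands.
by apply: eq_map => z; rewrite mulN1r.
Qed.

Lemma expands_monomialM N M s f x :
  expands M s f ->
  expands (N + M) [seq x * z | z <- s] (monomial x (2 * N) * f).
Proof.
elim: s M f => [|y s IHs] M f /=.
  by move=> fM; apply: order_geM fM; exact: order_ge_monomial.
by move=> /IHs; rewrite addrA mulrBr monomialM mulrDr.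
Qed.

(** Induction on [s] through f g - x y v^(N+M) = x v^N (g - y v^M) + (f - x v^N) g: the first
    summand carries the tail of [t], the second is the induction hypothesis. *)
Lemma expandsM N M s t f g :
  expands N s f -> expands M t g -> expands (N + M) (mul_seq s t) (f * g).
Proof.
elim: s N f => [|x s IHs] N f.
  by move=> /expands_order + /expands_order; exact: order_geM.
case: t IHs => [|y t] IHs.
  by move=> /expands_order + /expands_order; exact: order_geM.
move=> /= fs gt; rewrite mulrDr -monomialM.
have -> : f * g - monomial x (2 * N) * monomial y (2 * M) =
    monomial x (2 * N) * (g - monomial y (2 * M))
    + (f - monomial x (2 * N)) * g.
  by rewrite mulrBr mulrBl [RHS]addrC addrA addrNK.
rewrite -addrA; apply: expandsD; first exact: expands_monomialM.
by rewrite [M + 1]addrC addrA; exact: IHs.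
Qed.

(** Lists can be added entry by entry only from a common starting power; leading zeros supply it. *)
Lemma expands_shift N (m : nat) s f :
  expands (N + m%:Z) s f -> expands N (nseq m 0 ++ s) f.
Proof.
elim: m N f => [|m IHm] N f /=; first by rewrite addr0.
by move=> fs; apply: IHm; rewrite monomial0 subr0 -addrA -intS.
Qed.

(** A Laurent polynomial has no error term, so trailing zeros extend it to any precision. *)
Lemma expands_vpoly N (m : nat) s : expands N (s ++ nseq m 0) (vpoly N s).
Proof.
elim: s N => [|x s IHs] N /=; last by rewrite [monomial _ _ + _]addrC addrK.
elim: m N => [|m IHm] N /=; first exact: order_ge0.
by rewrite monomial0 subr0.
Qed.

(** * Power series in v, the test for regularity, and d/dt on expansions *)

Lemma thirds_odd c n : ~ (exists k : nat, n = 2 * k%:Z) -> thirds c n = 0 :> F.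
Proof.
case: n => //= n nP; case: ifPn => // n2; case: nP; exists n./2; lia.
Qed.

Lemma coef_thirds c (k : nat) : thirds c (2 * k%:Z) = c k :> F.
Proof.
have -> : 2 * k%:Z = (k.*2)%:Z by lia.
by rewrite /= odd_double doubleK.
Qed.

Lemma expands_mkseq N (K : nat) f : order_ge N f ->
  expands N (mkseq (fun k => f (2 * (N + k%:Z))) K) f.
Proof.
elim: K N f => [//|K IHK] N f fN.
rewrite /mkseq /= addr0 (iotaDl 1 0 K : iota 1 K = _) -map_comp.
set g := f - _.
have gE (k : nat) : f (2 * (N + (1 + k)%N%:Z)) = g (2 * (N + 1 + k%:Z)).
  rewrite coef_addl coef_oppl coef_monomial ifF; last lia.
  by rewrite subr0 PoszD addrA.
rewrite (eq_map gE); apply: IHK => n.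
rewrite coef_addl coef_oppl coef_monomial.
case: (n =P _) => [->|nN]; first by rewrite subrr eqxx.
by rewrite subr0 => /fN[k nk]; exists k.-1; lia.
Qed.

Lemma order_thirds c : order_ge 0 (thirds c).
Proof.
by move=> n; apply: contraNP => nP; rewrite thirds_odd.
Qed.

Lemma expands_thirds (c : nat -> F) (K : nat) :
  expands 0 (mkseq c K) (thirds c).
Proof.
rewrite (eq_mkseq (g := fun k : nat => thirds c (2 * (0 + k%:Z)))).
  exact/expands_mkseq/order_thirds.
by move=> k; rewrite add0r coef_thirds.
Qed.

Lemma order_ge_thirds f : order_ge 0 f -> exists c, f = thirds c.
Proof.
move=> f0; exists (fun k => f (2 * k%:Z)); apply: laurentP => n.
have [[k ->]|nP] := pselect (exists k : nat, n = 2 * k%:Z).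
  by rewrite coef_thirds.
rewrite thirds_odd//; apply/eqP; apply: contraT => /f0[k nk].
by case: nP; exists k; lia.
Qed.

Lemma expands_nseq0 N (m : nat) s f :
  expands N (nseq m 0 ++ s) f -> order_ge (N + m%:Z) f.
Proof.
elim: m N f => [|m IHm] N f /=; first by rewrite addr0; exact: expands_order.
by rewrite monomial0 subr0 => /IHm; rewrite -addrA -intS.
Qed.

(** The regularity test: only the finitely many coefficients at negative powers have to be computed,
    since the remainder has order at least 0. *)
Lemma expands_regular N (m : nat) s f :
  expands N (nseq m 0 ++ s) f -> N + m%:Z = 0 -> exists c, f = thirds c.
Proof. by move=> /expands_nseq0 + Nm; rewrite Nm; exact: order_ge_thirds. Qed.

(* d/dt multiplies v^k by (k/3) v^-3; x is the exponent of the head of s. *)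
Fixpoint ddt_seq x s :=
  if s is y :: s' then x / 3 * y :: ddt_seq (x + 1) s' else [::].

(** The exponent 2N in u is divided by 6, which gives N/3; [6 != 0] makes both 2 and 3
    invertible. *)
Lemma ddt_monomial x N : (6 : F) != 0 ->
  ddt (monomial x (2 * N)) = monomial (N%:~R / 3 * x) (2 * (N - 3)).
Proof.
move=> n6; apply: laurentP => n /=.
rewrite (_ : (n + 6 == 2 * N) = (n == 2 * (N - 3))); last lia.
case: (n =P _) => [->|]; last by rewrite mulr0.
rewrite (_ : 2 * (N - 3) + 6 = 2 * N); last lia.
have [n3 n2] : (3 : F) != 0 /\ (2 : F) != 0.
  by apply/andP; rewrite -negb_or -mulf_eq0 -natrM.
by rewrite intrM; field; rewrite n6 n3.
Qed.

Lemma expands_ddt N s f x : (6 : F) != 0 -> x = N%:~R ->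
  expands N s f -> expands (N - 3) (ddt_seq x s) (ddt f).
Proof.
move=> n6; elim: s N f x => [|y s IHs] N f x xN /=.
  move=> fN n /=; rewrite mulf_eq0 negb_or => /andP[_ /fN[k nk]]; exists k; lia.
move=> /IHs; rewrite {x}xN => /(_ (N%:~R + 1)); rewrite -intrD1 => /(_ erefl).
rewrite [N + 1 - 3]addrAC -ddt_monomial//; congr expands.
by apply: laurentP => n; rewrite !coef_addl !coef_oppl /= mulrBr.
Qed.

End LaurentCoef.
Arguments expands : simpl never.
Arguments vpoly : simpl never.

(** * The gauge matrix *)

Section Gauge.
Variable F : numFieldType.
Implicit Types (p q r s : laurent F) (l W : F).

Lemma ord2P (k : 'I_2) : k = 0 \/ k = 1.
Proof. by case: k => -[|[|//]] kP; [left|right]; exact: val_inj. Qed.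

Lemma mx2P (M N : 'M[laurent F]_2) :
  [/\ M 0 0 = N 0 0, M 0 1 = N 0 1, M 1 0 = N 1 0 & M 1 1 = N 1 1] -> M = N.
Proof.
case=> e00 e01 e10 e11; apply/matrixP => i j.
by case: (ord2P i) (ord2P j) => -> [->|->].
Qed.

Lemma mx2E p q r s : (mx2 p q r s 0 0 = p) * (mx2 p q r s 0 1 = q) *
  (mx2 p q r s 1 0 = r) * (mx2 p q r s 1 1 = s).
Proof. by rewrite !mxE. Qed.

Lemma mx2M p q r s p' q' r' s' : mx2 p q r s *m mx2 p' q' r' s' =
  mx2 (p * p' + q * r') (p * q' + q * s') (r * p' + s * r') (r * q' + s * s').
Proof.
by apply: mx2P; split; rewrite !mxE !big_ord_recl big_ord0 !mxE /= addr0.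
Qed.

Lemma mx2D p q r s p' q' r' s' :
  mx2 p q r s + mx2 p' q' r' s' = mx2 (p + p') (q + q') (r + r') (s + s').
Proof. by apply: mx2P; split; rewrite !mxE. Qed.

Lemma mx2Z (x : laurent F) p q r s :
  x *: mx2 p q r s = mx2 (x * p) (x * q) (x * r) (x * s).
Proof. by apply: mx2P; split; rewrite !mxE. Qed.

(** Coefficients in v of the entries of Q, from the orders 0, -3, -1 and -4 on; every second one
    vanishes. *)
Definition gauge11 l W := [:: - W^-1; 0; l / (2 * W) + (4 * l)^-1; 0; 8^-1].
Definition gauge12 l W := [:: W^-1; 0; l / (2 * W) - (4 * l)^-1; 0; 8^-1].
Definition gauge21 l W := [:: -1; 0; l / 2 - W / (4 * l); 0; - (W / 8)].
Definition gauge22 l W := [:: 1; 0; l / 2 + W / (4 * l); 0; - (W / 8)].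
Definition gauge_mx l W : 'M[laurent F]_2 :=
  mx2 (vpoly 0 (gauge11 l W)) (vpoly (-3) (gauge12 l W))
      (vpoly (-1) (gauge21 l W)) (vpoly (-4) (gauge22 l W)).

Lemma gaugeE (x sl sw : F) : x ^+ 2 = 2 -> sl != 0 -> sw != 0 ->
  gauge x sl sw = gauge_mx (sl ^+ 2) (sw ^+ 2).
Proof.
move=> x2 sl0 sw0; have x0 : x != 0 by rewrite -sqrf_eq0 x2 pnatr_eq0.
have [x4 x8] : 4 = x ^+ 4 /\ 8 = x ^+ 6.
  by rewrite (exprM x 2 2) (exprM x 2 3) x2 -!natrX.
rewrite /gauge /sigma3 /sigma1 mx2D mx2Z /pow_sigma3 /u !algE !monomialX.
rewrite !expr1n !(addr0, add0r, mulr1, mulrN1) -[1]/(monomial 1 0).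
rewrite !monomialV ?invr_eq0 ?expf_neq0 ?oner_eq0 ?pnatr_eq0// !invrK !invr1.
(* Fourteen factors, hence thirteen products. *)
do 13 rewrite mx2M !(mulr0, mul0r, addr0, add0r, mulrDl, mulrN, mulNr,
  monomialM, mul1r, mulr1, opprK, opprD).
(* Each entry of the product is a sum of four monomials, the middle two with the same exponent;
   merging them leaves the three nonzero terms of the [vpoly]. *)
have sumE a1 a2 a3 a4 c0 c1 c2 k0 k2 k4 i j :
    a1 = c2 -> a2 + a3 = c1 -> a4 = c0 ->
    monomial a1 k4 + monomial a2 k2 + (monomial a3 k2 + monomial a4 k0) =
    monomial c0 k0 + (monomial 0 i +
      (monomial c1 k2 + (monomial 0 j + (monomial c2 k4 + 0)))) :> laurent F.
  move=> -> <- ->; rewrite !monomial0 -monomialD !add0r addr0.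
  ring.
rewrite !monomialN.
(* Writing 2 = x ^+ 2 everywhere makes these identities of rational functions
   in x, sl and sw. *)
apply: mx2P; split; rewrite !mxE /vpoly /=; apply: sumE;
  rewrite ?x8 ?x4 -?x2; field; by rewrite ?x0 ?sl0 ?sw0.
Qed.

Lemma det_mx2 p q r s : \det (mx2 p q r s) = p * s - q * r.
Proof.
rewrite (expand_det_row _ 0) !big_ord_recl big_ord0 /cofactor !det_mx11 !mxE /=.
by rewrite expr0 expr1 mul1r mulN1r mulrN addr0.
Qed.

Lemma invmx_mx2 (M : 'M[laurent F]_2) : \det M = 1 ->
  invmx M = mx2 (M 1 1) (- M 0 1) (- M 1 0) (M 0 0).
Proof.
move=> M1; have MU : M \in unitmx by rewrite unitmxE M1 unitr1.
apply: (can_inj (mulKmx MU)); rewrite mulmxV//.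
move: M1; have -> : M = mx2 (M 0 0) (M 0 1) (M 1 0) (M 1 1).
  by apply: mx2P; rewrite !mxE.
rewrite det_mx2 !mxE /= mx2M => M1; apply: mx2P; rewrite !mxE /= -M1.
split; ring.
Qed.

(** The diagonal powers have determinant 1, while [sigma3] and the three factors (sigma3 +
    sigma1)/sqrt 2 each have determinant -1. *)
Lemma det_gauge (x sl sw : F) : x ^+ 2 = 2 -> sl != 0 -> sw != 0 ->
  \det (gauge x sl sw) = 1.
Proof.
move=> x2 sl0 sw0; have x0 : x != 0 by rewrite -sqrf_eq0 x2 pnatr_eq0.
have detP (f : laurent F) : f \is a GRing.unit -> \det (pow_sigma3 f) = 1.
  by move=> fU; rewrite det_mx2 mulrV// mulr0 subr0.
have mU (y : F) k : y != 0 -> monomial y k \is a GRing.unit.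
  move=> y0; apply/unitrPr; exists (monomial y^-1 (- k)).
  by rewrite monomialM mulfV// subrr.
have aU (y : F) : y != 0 -> y%:A \is a @GRing.unit (laurent F).
  by move=> y0; rewrite algE mU.
have uU i : u ^+ i \is a @GRing.unit (laurent F).
  by rewrite unitrX// mU// oner_eq0.
have detH : \det (x^-1%:A *: (@sigma3 F + sigma1 F)) = -1.
  rewrite detZ /sigma3 /sigma1 mx2D det_mx2 !(addr0, add0r) mulr1 mulrN1.
  rewrite algE monomialX mulrBr mulrN mulr1 -opprD monomialD -mulr2n -mulr_natl.
  by rewrite exprVn x2 mulfV ?pnatr_eq0// mul0rn.
rewrite /gauge !det_mulmx detH !detP ?aU ?uU ?invr_eq0 ?pnatr_eq0//;
  last by rewrite -[u]expr1 uU.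
by rewrite det_mx2 !(mulr1, mul1r, mulrN, mulr0, subr0, opprK).
Qed.
End Gauge.

(** * The connection matrix *)

Lemma eq_cons (T : Type) (x y : T) s t : x = y -> s = t -> x :: s = y :: t.
Proof. by move=> -> ->. Qed.

Ltac seq_field := rewrite /=; repeat (apply: eq_cons; first by field).

Section ConnectionExpansion.
Variable F : numFieldType.
Implicit Types (l : F).
Variables (b a0 a9 a11 : F) (c : nat -> F).
Hypothesis sol : puiseux_solution b a0 a9 a11 c.
Let a := thirds c.

(** This list and the next two are the ten leading coefficients of p, q and r, from the orders -5,
    -8 and -2 on; the solution enters only through b, a_0 and a_9. *)
Definition conn11 : seq F :=
  [:: - (1 / 30); 0; 0; 0; 1 / 7 * b; 0; - (2 / 9 * a0); 1; - (9 / 10 * a9); 0].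
Definition conn12 l : seq F :=
  [:: 1 / 30; 0; 1 / 30 * l; 0; - (3 / 7 * b) + 1 / 30 * l ^+ 2; 0;
      5 / 9 * a0 - 4 / 7 * b * l + 1 / 30 * l ^+ 3; - (7 / 5);
      21 / 10 * a9 + 2 / 3 * a0 * l + 120 / 49 * b ^+ 2 - 5 / 7 * b * l ^+ 2
        + 1 / 30 * l ^+ 4;
      - (4 / 5 * l)].
Definition conn21 l : seq F :=
  [:: - (1 / 30); 0; 1 / 30 * l; 0; - (1 / 7 * b); 0; 1 / 9 * a0; - (2 / 5);
      3 / 10 * a9; 0].

Lemma expands_da :
  expands (-2)
    [:: - (1 / 3); 0; 0; 0; - (10 / 7 * b); 0; 10 / 9 * a0; - 4; 3 * a9; 0]
    (ddt a).
Proof.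
have [_ [[c0 c9 c11] [[c1 c2 c3 c4] [[c5 c6 c7 c8] [c10 c12]]]]] := sol.
have n6 : (6 : F) != 0 by rewrite pnatr_eq0.
have := expands_ddt n6 (erefl : 0 = 0%:~R :> F) (expands_thirds c 11).
rewrite /mkseq /= c0 c1 c2 c3 c4 c5 c6 c7 c8 c9 c10 => da.
(* The derivative kills the constant a_0, so the eleven terms a_0, ..., a_10 give ten terms starting
   at v^-2 instead of v^-3. *)
apply: (expands_eq (expands_behead (expands_eq da erefl _)) erefl);
  last reflexivity.
by seq_field.
Qed.

Lemma expands_d2a :
  expands (-5)
    [:: 2 / 9; 0; 0; 0; - (20 / 21 * b); 0; 40 / 27 * a0; - (20 / 3); 6 * a9;
        0]
    (ddt (ddt a)).
Proof.
apply: expands_eq (expands_ddt (x := -2) _ _ expands_da) _ _;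
  rewrite ?pnatr_eq0//.
by seq_field.
Qed.

Lemma expands_d3a :
  expands (-8)
    [:: - (10 / 27); 0; 0; 0; 20 / 63 * b; 0; 40 / 81 * a0; - (40 / 9); 6 * a9;
        0]
    (ddt (ddt (ddt a))).
Proof.
apply: expands_eq (expands_ddt (x := -5) _ _ expands_d2a) _ _;
  rewrite ?pnatr_eq0//.
by seq_field.
Qed.

Lemma expands_da2 :
  expands (-4)
    [:: 1 / 9; 0; 0; 0; 20 / 21 * b; 0; - (20 / 27 * a0); 8 / 3;
        - (2 * a9) + 100 / 49 * b ^+ 2; 0] (ddt a ^+ 2).
Proof.
rewrite expr2; apply: expands_eq (expandsM expands_da expands_da) _ _ => //.
by seq_field.
Qed.

Lemma expands_da3 :
  expands (-6)
    [:: - (1 / 27); 0; 0; 0; - (10 / 21 * b); 0; 10 / 27 * a0; - (4 / 3);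
        a9 - 100 / 49 * b ^+ 2; 0] (ddt a ^+ 3).
Proof.
rewrite exprS; apply: expands_eq (expandsM expands_da expands_da2) _ _ => //.
by seq_field.
Qed.

Lemma expands_da4 :
  expands (-8)
    [:: 1 / 81; 0; 0; 0; 40 / 189 * b; 0; - (40 / 243 * a0); 16 / 27;
        - (4 / 9 * a9) + 200 / 147 * b ^+ 2; 0] (ddt a ^+ 4).
Proof.
rewrite (exprD _ 2 2).
apply: expands_eq (expandsM expands_da2 expands_da2) _ _ => //.
by seq_field.
Qed.

Lemma expands_scalar x (m : nat) : expands 0 (x :: nseq m 0) (x%:A : laurent F).
Proof. by have := expands_vpoly 0 m [:: x]; rewrite /vpoly /= addr0 algE. Qed.

Lemma expands_tvar : expands 0 [:: b; 0; 0; 1; 0; 0; 0; 0; 0; 0] (tvar b).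
Proof.
have := expands_vpoly 0 6 [:: b; 0; 0; 1].
by rewrite /vpoly /= !monomial0 !add0r addr0 /tvar /u monomialX expr1n algE.
Qed.

Lemma connectionE l : exists p q r,
  [/\ connection b a l = mx2 p q r (- p), expands (-5) conn11 p,
      expands (-8) (conn12 l) q & expands (-2) (conn21 l) r].
Proof.
have [_ [[c0 c9 c11] [[c1 c2 c3 c4] [[c5 c6 c7 c8] [c10 c12]]]]] := sol.
have ea : expands 0
    [:: a0; -1; 0; 0; 0; - (6 / 7) * b; 0; 10 / 21 * a0; - (3 / 2); a9; 0] a.
  have := expands_thirds c 11.
  by rewrite /mkseq /= c0 c1 c2 c3 c4 c5 c6 c7 c8 c9 c10.
have shift n (m : nat) (s : seq F) f :
    expands (n + m%:Z) s f -> expands n (nseq m 0 ++ s) f.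
  exact: expands_shift.
(* The entry q starts at v^-8, the order of a''' and (a')^4; all its other terms are padded down to
   that order. *)
have e1 := @shift (-8) 6 _ _ expands_da.
have e2 := @shift (-8) 4 _ _ expands_da2.
have e3 := @shift (-8) 2 _ _ expands_da3.
have e4 := expands_da4.
have e5 := expands_d3a.
have e0 := @shift (-8) 8 _ _ ea.
have et := @shift (-8) 8 _ _ expands_tvar.
have et1 := @shift (-8) 6 _ _ (expandsM expands_da expands_tvar).
have et2 := @shift (-8) 4 _ _ (expandsM expands_tvar expands_da2).
have et2' := @shift (-8) 4 _ _ (expandsM expands_da2 expands_tvar).
have ett := @shift (-8) 8 _ _ (expandsM expands_tvar expands_tvar).
rewrite -expr2 in ett.
have ea1 := @shift (-8) 6 _ _ (expandsM ea expands_da).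
rewrite /connection -/a /sigma3 /sigma_plus /sigma_minus !mx2Z !mx2D.
rewrite !(mulr0, addr0, add0r, mulr1, mulrN1).
do 3 eexists; split; first reflexivity.
- by apply: expands_eq (expandsZ (- (3 / 20)) expands_d2a) _ _ => //; seq_field.
(* The list for q stays open while the sum is assembled term by term, and is compared with [conn12]
   only at the end. *)
- apply: expands_eq.
  (* Eight zeros, the constant and one more zero make ten entries, so that addition truncates
     nothing that is needed. *)
  have ec := @shift (-8) 8 _ _ (expands_scalar (1 / 30 * l ^+ 4) 1).
  apply: expandsD; first (apply: expandsD; first (apply: expandsD;
    first (apply: expandsD; first exact: ec))).
  + exact/expandsZ/expandsZ/e1.
  + by apply/expandsZ/expandsD; [exact/expandsZ/e2|exact/expandsN/et].
  + apply/expandsZ/expandsD; last exact: e0.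
    by apply/expandsD; [exact/expandsZ/e3|exact/expandsZ/et1].
  + apply: expandsD; last first.
      exact/expandsZ/ett.
    apply: expandsD; last first.
      apply/expandsZ/expandsD; last exact/expandsN/expandsZ/ett.
      apply/expandsD; last exact/expandsZ/et2'.
      apply/expandsD; last exact/expandsN/expandsZ/e4.
      exact/expandsZ/e5.
    apply: expandsD; last exact/expandsZ/et2.
    apply: expandsD; last exact/expandsN/expandsZ/e4.
    exact/expandsZ/ea1.
  reflexivity.
  by seq_field.
- have ec := @shift (-2) 2 _ _ (expands_scalar (1 / 30 * l) 7).
  apply: expands_eq
    (expandsD ec (expandsN (expandsZ (- (1 / 10)) expands_da))) _ _ => //.
  by seq_field.
Qed.

End ConnectionExpansion.

(** * The transformed connection *)

Section GaugeTransform.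
Variable F : numFieldType.
Implicit Types (l W b : F).

(* Derivatives in l, where W depends on l through dW/dl = - 2 l *)
Definition dgauge11 l W :=
  [:: - (2 * l / W ^+ 2); 0;
      (2 * W)^-1 + l ^+ 2 / W ^+ 2 - (4 * l ^+ 2)^-1; 0; 0].
Definition dgauge12 l W :=
  [:: 2 * l / W ^+ 2; 0;
      (2 * W)^-1 + l ^+ 2 / W ^+ 2 + (4 * l ^+ 2)^-1; 0; 0].
Definition dgauge21 l W := [:: 0; 0; 1 + W / (4 * l ^+ 2); 0; l / 4].
Definition dgauge22 l W := [:: 0; 0; - (W / (4 * l ^+ 2)); 0; l / 4].
Definition dgauge_mx l W : 'M[laurent F]_2 :=
  mx2 (vpoly 0 (dgauge11 l W)) (vpoly (-3) (dgauge12 l W))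
      (vpoly (-1) (dgauge21 l W)) (vpoly (-4) (dgauge22 l W)).

(** The hypothesis on [b] is W = 120/7 b - l^2 solved for b; each cancellation thus becomes an
    identity of rational functions in a_0, a_9, l and W. *)
Lemma gauge_transform_regular b a0 a9 l W (p q r : laurent F) :
  l != 0 -> W != 0 -> b = 7 / 120 * (W + l ^+ 2) ->
  expands (-5) (conn11 b a0 a9) p ->
  expands (-8) (conn12 b a0 a9 l) q ->
  expands (-2) (conn21 b a0 a9 l) r ->
  let g := gauge_mx l W in
  let g' := mx2 (g 1 1) (- g 0 1) (- g 1 0) (g 0 0) in
  forall i j, exists c,
    (g *m mx2 p q r (- p) *m g' + dgauge_mx l W *m g') i j = thirds c.
Proof.
move=> l0 W0 -> ep eq er g g'.
(* Five coefficients and five zeros match the ten-term precision of p, q and r. *)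
have e11 := expands_vpoly 0 5 (gauge11 l W).
have e12 := expands_vpoly (-3) 5 (gauge12 l W).
have e21 := expands_vpoly (-1) 5 (gauge21 l W).
have e22 := expands_vpoly (-4) 5 (gauge22 l W).
have d11 := expands_vpoly 0 5 (dgauge11 l W).
have d12 := expands_vpoly (-3) 5 (dgauge12 l W).
have d21 := expands_vpoly (-1) 5 (dgauge21 l W).
have d22 := expands_vpoly (-4) 5 (dgauge22 l W).
pose x11 := vpoly 0 (gauge11 l W); pose x12 := vpoly (-3) (gauge12 l W).
pose x21 := vpoly (-1) (gauge21 l W); pose x22 := vpoly (-4) (gauge22 l W).
pose y11 := vpoly 0 (dgauge11 l W); pose y12 := vpoly (-3) (dgauge12 l W).
pose y21 := vpoly (-1) (dgauge21 l W); pose y22 := vpoly (-4) (dgauge22 l W).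
(* [x1], [x2] and [x3] expand the (1,1), (1,2) and (2,1) entries of Q A Q^-1; its trace is zero, so
   the (2,2) entry is minus the first. *)
have x1 := expandsD (expandsD
    (expandsM ep (expandsD (expandsM e11 e22) (expandsM e12 e21)))
    (expandsM er (expandsM e12 e22)))
  (expandsN (expandsM eq (expandsM e11 e21))).
have x2 := expandsD (expandsD (expandsM eq (expandsM e11 e11))
    (expandsN (expandsM er (expandsM e12 e12))))
  (expandsN (expandsZ 2 (expandsM ep (expandsM e11 e12)))).
have x3 := expandsD (expandsD (expandsM er (expandsM e22 e22))
    (expandsN (expandsM eq (expandsM e21 e21))))
  (expandsZ 2 (expandsM ep (expandsM e21 e22))).
have [c11 c11E] : exists c,
    p * (x11 * x22 + x12 * x21) + r * (x12 * x22) - q * (x11 * x21)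
    + (y11 * x22 - y12 * x21) = thirds c.
  have ey := expandsD (expandsM d11 e22) (expandsN (expandsM d12 e21)).
  apply: (@expands_regular _ (-9) 9); last by [].
  (* In every entry the list for Q_lambda Q^-1 starts five powers of v above the one for Q A
     Q^-1. *)
  apply: expands_eq (expandsD x1 (@expands_shift _ (-9) 5 _ _ ey)) _ _ => //=.
  by do 9 (apply: eq_cons; first by field; rewrite ?l0 ?W0).
have [c22 c22E] : exists c,
    - (p * (x11 * x22 + x12 * x21) + r * (x12 * x22) - q * (x11 * x21))
    + (y22 * x11 - y21 * x12) = thirds c.
  have ey := @expands_shift _ (-9) 5 _ _
    (expandsD (expandsM d22 e11) (expandsN (expandsM d21 e12))).
  apply: (@expands_regular _ (-9) 9); last by [].
  apply: expands_eq (expandsD (expandsN x1) ey) _ _ => //=.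
  by do 9 (apply: eq_cons; first by field; rewrite ?l0 ?W0).
have [c12 c12E] : exists c,
    q * (x11 * x11) - r * (x12 * x12) - (2 : F) *: (p * (x11 * x12))
    + (y12 * x11 - y11 * x12) = thirds c.
  have ey := expandsD (expandsM d12 e11) (expandsN (expandsM d11 e12)).
  apply: (@expands_regular _ (-8) 8); last by [].
  apply: expands_eq (expandsD x2 (@expands_shift _ (-8) 5 _ _ ey)) _ _ => //=.
  by do 8 (apply: eq_cons; first by field; rewrite ?l0 ?W0).
have [c21 c21E] : exists c,
    r * (x22 * x22) - q * (x21 * x21) + (2 : F) *: (p * (x21 * x22))
    + (y21 * x22 - y22 * x21) = thirds c.
  have ey := expandsD (expandsM d21 e22) (expandsN (expandsM d22 e21)).
  (* Here all ten known coefficients belong to negative powers, so the tail is empty. *)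
  apply: (@expands_regular _ (-10) 10 [::]); last by [].
  apply: expands_eq (expandsD x3 (@expands_shift _ (-10) 5 _ _ ey)) _ _ => //=.
  by do 10 (apply: eq_cons; first by field; rewrite ?l0 ?W0).
have scale2 (f : laurent F) : (2 : F) *: f = f + f by rewrite scaler_nat mulr2n.
have gE : g' = mx2 x22 (- x12) (- x21) x11 by rewrite /g' /g !mxE.
rewrite gE /g /gauge_mx /dgauge_mx.
rewrite -/x11 -/x12 -/x21 -/x22 -/y11 -/y12 -/y21 -/y22.
clearbody x11 x12 x21 x22 y11 y12 y21 y22; rewrite !mx2M mx2D => i j.
case: (ord2P i) (ord2P j) => -> [->|->]; rewrite mxE /=.
- exists c11; rewrite -c11E; ring.
- exists c12; rewrite -c12E scale2; ring.
- exists c21; rewrite -c21E scale2; ring.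
- exists c22; rewrite -c22E; ring.
Qed.
End GaugeTransform.

(** * Rationality and the derivative in lambda *)

Section Eval2.
Variable F : fieldType.
Implicit Types (lam x : F) (s : seq F).

Lemma mul_monomial_vpoly x M N s :
  monomial x (2 * M) * vpoly N s = vpoly (M + N) [seq x * z | z <- s].
Proof.
elim: s N => [|y s IHs] N; first exact: mulr0.
by rewrite /= !vpoly_cons mulrDr IHs monomialM -mulrDr addrA.
Qed.

Lemma vpoly_shift N M (m : nat) s :
  M = N + m%:Z -> vpoly M s = vpoly N (nseq m 0 ++ s).
Proof.
move=> ->; elim: m N => [|m IHm] N /=; first by rewrite addr0.
by rewrite vpoly_cons monomial0 add0r -IHm -addrA -intS.
Qed.

(** Horner's scheme in v; it turns the rationality claim into an equality of coefficient lists. *)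
Lemma eval2_Poly lam (ps : seq {poly F}) :
  eval2 lam (Poly ps) = vpoly 0 [seq p.[lam] | p <- ps].
Proof.
have u2 : u ^+ 2 = monomial 1 (2 * 1) :> laurent F.
  by rewrite /u monomialX expr1n.
elim: ps => [|p ps IHps]; first by rewrite /eval2 [Poly _]/= map_poly0 horner0.
have vS (s : seq F) : vpoly (0 + 1) s = u ^+ 2 * vpoly 0 s.
  rewrite u2 mul_monomial_vpoly [0 + 1]addrC (eq_map (g := id)) ?map_id//.
  by move=> z; rewrite mul1r.
rewrite [map _ _]/= vpoly_cons vS -IHps /eval2 [Poly _]/= cons_poly_def.
set f := fun q : {poly F} => _; rewrite -algE [RHS]addrC [u ^+ 2 * _]mulrC.
rewrite -hornerMXaddC; congr (_.[_]).
(* [f] is a bare function, so reading coefficients through [map_poly] requires that it preserve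
   0. *)
have f0 : f 0 = 0 by rewrite /f horner0 scale0r.
apply/polyP => i; rewrite coefD coefMX coefC !coef_map_id0//.
rewrite !coefD coefMX coefC.
by case: i => [|i]; rewrite /= ?add0r ?addr0.
Qed.

End Eval2.

(** * Differentiation in lambda, coefficient by coefficient *)

Section LamDerivative.
Variable K : numFieldType.
Implicit Types (l d e : K^o) (f g : K^o -> K^o).

Lemma is_derive_add f g l d e : is_derive l 1 f d -> is_derive l 1 g e ->
  is_derive l 1 (fun x => f x + g x : K^o) (d + e : K^o).
Proof. exact: is_deriveD. Qed.

Lemma is_derive_opp f l d : is_derive l 1 f d ->
  is_derive l 1 (fun x => - f x : K^o) (- d : K^o).
Proof. exact: is_deriveN. Qed.

Lemma is_derive_mul f g l d e : is_derive l 1 f d -> is_derive l 1 g e ->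
  is_derive l 1 (fun x => f x * g x : K^o) (f l * e + g l * d : K^o).
Proof. exact: is_deriveM. Qed.

Lemma is_derive_inv f l d : f l != 0 -> is_derive l 1 f d ->
  is_derive l 1 (fun x => (f x)^-1 : K^o) (- d / f l ^+ 2 : K^o).
Proof.
move=> fl [fd <-]; apply: DeriveDef; first exact: derivableV.
by rewrite deriveV// mulNr mulrC -mulNr.
Qed.

Lemma is_derive_vpoly_nil N n l :
  is_derive l 1 (fun x => vpoly N [::] n : K^o) (vpoly N [::] n : K^o).
Proof. by rewrite /vpoly; apply: is_derive_eq; rewrite coef_zerol. Qed.

(** The exponents do not depend on the variable, so the n-th coefficient of the head is either [f]
    or constantly 0. *)
Lemma is_derive_vpoly_cons N n f (s : K^o -> seq K) l d (ds : seq K) :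
  is_derive l 1 f d ->
  is_derive l 1 (fun x => vpoly (N + 1) (s x) n : K^o)
    (vpoly (N + 1) ds n : K^o) ->
  is_derive l 1 (fun x => vpoly N (f x :: s x) n : K^o)
    (vpoly N (d :: ds) n : K^o).
Proof.
move=> fd; apply: (is_derive_add (f := fun x => monomial (f x) (2 * N) n)
  (g := fun x => vpoly (N + 1) (s x) n) (d := monomial d (2 * N) n)).
rewrite coef_monomial.
under eq_fun do rewrite coef_monomial.
by case: ifP => // _; exact: is_derive_cst.
Qed.

End LamDerivative.

Section GaugeMatrix.
Variable F : numFieldType.

Lemma is_derive_gauge_mx (k l : F^o) i j n : l != 0 -> k - l ^+ 2 != 0 ->
  is_derive l 1 (fun x : F^o => gauge_mx x (k - x ^+ 2) i j n : F^o)
    (dgauge_mx l (k - l ^+ 2) i j n).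
Proof.
move=> l0 W0.
have dcst (x : F^o) : is_derive l 1 (fun=> x : F^o) (0 : F^o).
  exact: is_derive_cst.
have did : is_derive l 1 (fun x : F^o => x) (1 : F^o).
  exact: is_derive_id.
have dW : is_derive l 1 (fun x : F^o => k - x ^+ 2 : F^o) (- (2 * l) : F^o).
  have dl2 := is_derive_opp (is_derive_mul did did).
  apply: is_derive_eq (is_derive_add (dcst k) dl2) _.
  by ring.
have dWV := is_derive_inv (f := fun x : F^o => k - x ^+ 2) W0 dW.
have n2 : 2 != 0 :> F by rewrite pnatr_eq0.
have n4 : 4 != 0 :> F by rewrite pnatr_eq0.
have d2W := is_derive_mul did
  (is_derive_inv (f := fun x : F^o => 2 * (k - x ^+ 2))
    (mulf_neq0 n2 W0) (is_derive_mul (dcst 2) dW)).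
have d4l := is_derive_inv (f := fun x : F^o => 4 * x)
  (mulf_neq0 n4 l0) (is_derive_mul (dcst 4) did).
have dW4l := is_derive_mul dW d4l.
have dl2 := is_derive_mul did (dcst 2^-1).
have dW8 := is_derive_opp (is_derive_mul dW (dcst 8^-1)).
(* All four entries have this sparse shape, so three scalar derivatives settle each of them. *)
have derivE m (f0 f2 f4 : F^o -> F^o) (e0 e2 e4 : F^o) :
    is_derive l 1 f0 e0 -> is_derive l 1 f2 e2 -> is_derive l 1 f4 e4 ->
    is_derive l 1 (fun x : F^o => vpoly m [:: f0 x; 0; f2 x; 0; f4 x] n : F^o)
      (vpoly m [:: e0; 0; e2; 0; e4] n : F^o).
  move=> df0 df2 df4; apply: is_derive_vpoly_cons df0 _.
  apply: is_derive_vpoly_cons (dcst 0) _; apply: is_derive_vpoly_cons df2 _.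
  apply: is_derive_vpoly_cons (dcst 0) _; apply: is_derive_vpoly_cons df4 _.
  exact: is_derive_vpoly_nil.
case: (ord2P i) (ord2P j) => -> [->|->];
  under eq_fun do rewrite mx2E; rewrite mx2E; apply: derivE.
- by apply: is_derive_eq (is_derive_opp dWV) _; field; rewrite W0.
- by apply: is_derive_eq (is_derive_add d2W d4l) _; field; rewrite l0 W0.
- by apply: is_derive_eq dWV _; field; rewrite W0.
- apply: is_derive_eq (is_derive_add d2W (is_derive_opp d4l)) _.
  by field; rewrite l0 W0.
- apply: is_derive_eq (is_derive_add dl2 (is_derive_opp dW4l)) _.
  by field; rewrite l0.
- by apply: is_derive_eq dW8 _; field.
- by apply: is_derive_eq (is_derive_add dl2 dW4l) _; field; rewrite l0.
- by apply: is_derive_eq dW8 _; field.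
Qed.
End GaugeMatrix.

(* gauge_num / gauge_den = Q, with common denominator 8 l W v^4 *)
Definition gauge_num (F : numFieldType) (k : F) : 'M[{poly {poly F}}]_2 :=
  let w : {poly F} := k%:P - 'X ^+ 2 in
  \matrix_(i, j) Poly (nth [::] (nth [::]
    [:: [:: [:: 0; 0; 0; 0; - (8 *: 'X); 0; 4 *: 'X ^+ 2 + 2 *: w; 0; 'X * w];
            [:: 0; 8 *: 'X; 0; 4 *: 'X ^+ 2 - 2 *: w; 0; 'X * w]];
        [:: [:: 0; 0; 0; - (8 *: ('X * w)); 0; 4 *: ('X ^+ 2 * w) - 2 *: w ^+ 2;
                0; - ('X * w ^+ 2)];
            [:: 8 *: ('X * w); 0; 4 *: ('X ^+ 2 * w) + 2 *: w ^+ 2; 0;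
                - ('X * w ^+ 2)]]] i) j).

Definition gauge_den (F : numFieldType) (k : F) : {poly {poly F}} :=
  Poly [:: 0; 0; 0; 0; 8 *: ('X * (k%:P - 'X ^+ 2))].

Lemma eval2_gauge (F : numFieldType) (k l : F) : l != 0 -> k - l ^+ 2 != 0 ->
  eval2 l (gauge_den k) != 0 /\
  forall i j, eval2 l (gauge_den k) * gauge_mx l (k - l ^+ 2) i j =
    eval2 l (gauge_num k i j).
Proof.
move=> l0 W0; set W := k - l ^+ 2.
have hE := (hornerZ, hornerM, hornerD, hornerN, hornerXn, hornerX, hornerC,
  horner0).
have -> : eval2 l (gauge_den k) = monomial (8 * l * W) (2 * 4).
  by rewrite eval2_Poly /= !hE -/W mulrA /vpoly !monomial0 !add0r addr0.
split.
  apply/eqP => /(congr1 (fun f : laurent F => f (2 * 4))).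
  rewrite coef_monomial coef_zerol eqxx.
  by apply/eqP; rewrite !mulf_neq0// pnatr_eq0.
move=> i j; case: (ord2P i) (ord2P j) => -> [->|->];
  rewrite /gauge_mx mx2E mxE mul_monomial_vpoly eval2_Poly.
(* The factor v^4 in the denominator turns the orders 0, -3, -1, -4 into 4, 1, 3, 0, the numbers of
   leading zeros in the four cases. *)
- rewrite (@vpoly_shift _ 0 _ 4)//; congr vpoly.
  rewrite /= !hE -/W.
  by do 9 (apply: eq_cons; first by field; rewrite ?l0 ?W0).
- rewrite (@vpoly_shift _ 0 _ 1)//; congr vpoly.
  rewrite /= !hE -/W.
  by do 6 (apply: eq_cons; first by field; rewrite ?l0 ?W0).
- rewrite (@vpoly_shift _ 0 _ 3)//; congr vpoly.
  rewrite /= !hE -/W.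
  by do 8 (apply: eq_cons; first by field; rewrite ?l0 ?W0).
- rewrite (@vpoly_shift _ 0 _ 0)//; congr vpoly.
  rewrite /= !hE -/W.
  by do 5 (apply: eq_cons; first by field; rewrite ?l0 ?W0).
Qed.

Theorem theorem4p1 (R : realType) (b a0 a9 a11 : R[i]) (c : nat -> R[i])
    (hc : puiseux_solution b a0 a9 a11 c)
    (D : set R[i]^o) (sqlam sqw : R[i]^o -> R[i]^o)
    (D_open : open D)
    (D_lam : forall lam, D lam -> lam != 0)
    (D_w : forall lam, D lam -> 120 / 7 * b - lam ^+ 2 != 0)
    (sqlam_cont : {within D, continuous sqlam})
    (sqlamE : forall lam, D lam -> sqlam lam ^+ 2 = lam)
    (sqw_cont : {within D, continuous sqw})
    (sqwE : forall lam, D lam -> sqw lam ^+ 2 = 120 / 7 * b - lam ^+ 2) :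
  let A := connection b (thirds c) in
  let Q := fun lam => gauge (sqrtC 2) (sqlam lam) (sqw lam) in
  rational_on D Q /\ regularizes D A Q.
Proof.
move=> A Q; pose k := 120 / 7 * b.
(* On [D] the chosen roots enter only through their squares, so Q has a closed form free of
   branches. *)
have QE lam : D lam -> Q lam = gauge_mx lam (k - lam ^+ 2).
  move=> Dlam; rewrite /Q gaugeE ?sqrtCK//; first by rewrite sqlamE// sqwE.
    by rewrite -sqrf_eq0 sqlamE// D_lam.
  by rewrite -sqrf_eq0 sqwE// D_w.
split.
  exists (gauge_den k), (gauge_num k) => lam Dlam; rewrite QE//.
  exact: eval2_gauge (D_lam _ Dlam) (D_w _ Dlam).
move=> lam Dlam; have [l0 W0] := (D_lam _ Dlam, D_w _ Dlam).
have det1 : \det (Q lam) = 1.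
  by rewrite det_gauge ?sqrtCK// -sqrf_eq0 (sqlamE, sqwE).
split; first by rewrite unitmxE det1 unitr1.
exists (dgauge_mx lam (k - lam ^+ 2)).
  (* The closed form is available only on [D]; as [D] is open, it holds near [lam] and the
     derivative carries over. *)
  move=> i j n; apply: near_eq_is_derive (is_derive_gauge_mx _ _ _ l0 W0).
  by near=> x; rewrite QE//; near: x; exact: open_nbhs_nbhs.
have [p [q [r [AE ep eq er]]]] := connectionE hc lam.
rewrite invmx_mx2// QE// /A AE; apply: gauge_transform_regular ep eq er => //.
rewrite /k; by field.
Unshelve. all: by end_near.
Qed.
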